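(* There is a universal constant $C$ such that the following holds. For all $\ell\ge2$, all $k\in\mathbb{N}_+$ and all $\kappa\in\mathbb{N}_+^\ell$ with $\min_i\{\kappa_i\}\ge\ell^{Ck}$, if $f:\mathcal{U}_\kappa\to\{0,1\}$ has degree at most $k$, then $f$ is a $\gamma_\ell(k)$-junta.
   Context: With $n=\kappa_1+\cdots+\kappa_\ell$, the multislice is $\mathcal{U}_\kappa=\{u\in[\ell]^n : u \text{ has exactly } \kappa_i \text{ coordinates equal to } i,\ \forall i\in[\ell]\}$. For $X=\mathcal{U}_\kappa$ or $X=[\ell]^n$, a function $g$ on $X$ is an $m$-junta if there is $J\subseteq[n]$ with $|J|\le m$ such that $g(u)$ depends only on $(u_j)_{j\in J}$ for $u\in X$; a function $f:X\to\mathbb{R}$ has degree at most $k$ if it is a linear combination of ($\mathbb{R}$-valued) $k$-juntas on $X$. The number $\gamma_\ell(k)$ is the least integer such that, for every $n$, every function $f:[\ell]^n\to\{0,1\}$ of degree at most $k$ is a $\gamma_\ell(k)$-junta (such an integer exists; in fact $\gamma_\ell(k)<22\cdot\ell^{2k}$). *)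

(* Defs.v *)
From mathcomp Require Import all_boot all_order all_algebra.
From mathcomp Require Import classical_sets reals.

Set Implicit Arguments.
Unset Strict Implicit.
Unset Printing Implicit Defensive.

Import Order.TTheory GRing.Theory Num.Theory.

Local Open Scope ring_scope.

(* The grid [l]^n; the alphabet {1, ..., l} is encoded as 'I_l. *)
Notation grid n l := {ffun 'I_n -> 'I_l}.

Definition multislice (l : nat) (kappa : 'I_l -> nat) :
    {set grid (\sum_(i < l) kappa i)%N l} :=
  [set u : grid (\sum_(i < l) kappa i)%N l
     | [forall i : 'I_l, #|[set j | u j == i]| == kappa i]].

(* A function on X, for X a subset of the grid, is represented by a function on
   the whole grid; the predicates below only look at its values on X. *)
Section Functions.
Variables (R : realType) (n l : nat) (X : {set grid n l}).

Definition is_junta (m : nat) (g : grid n l -> R) : Prop :=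
  exists J : {set 'I_n}, (#|J| <= m)%N /\
    forall u v : grid n l, u \in X -> v \in X ->
      (forall j, j \in J -> u j = v j) -> g u = g v.

Definition degree_le (k : nat) (f : grid n l -> R) : Prop :=
  exists (r : nat) (c : 'I_r -> R) (g : 'I_r -> grid n l -> R),
    (forall i, is_junta k (g i)) /\
    (forall u, u \in X -> f u = \sum_(i < r) c i * g i u).

Definition zero_one_valued (f : grid n l -> R) : Prop :=
  forall u, u \in X -> f u = 0 \/ f u = 1.

End Functions.

Definition bounds_juntas (R : realType) (l k m : nat) : Prop :=
  forall (n : nat) (f : grid n l -> R),
    zero_one_valued [set: grid n l] f -> degree_le [set: grid n l] k f ->
    is_junta [set: grid n l] m f.

(* The least m such that bounds_juntas R l k m. The default value 0 of xget
   plays no role: such an m exists, as every Boolean function of degree at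
   most k on [l]^n is an m-junta for some m < 22 * l ^ (2 * k). *)
Definition gamma (R : realType) (l k : nat) : nat :=
  xget 0%N [set m : nat | bounds_juntas R l k m /\
    forall m' : nat, bounds_juntas R l k m' -> (m <= m')%N]%classic.

(* Main.v *)
(* Every function on the slice is studied through the differences
   f - f \o swap (a, b).  Degree at most k makes all differences along more than
   k disjoint pairs vanish.  If f is not invariant under exchanging a and b, then
   a maximal chain of differences through (a, b) is nonzero and depends on its at
   most 2k coordinates only; so, for a suitable pattern on these, f is sensitive
   to (a, b) after some swaps inside them, whatever the other letters are.

   Take m disjoint noninvariant pairs, write uniform random letters on all the
   coordinates involved, and complete them to words of the slice in a way that
   depends only on letter counts, so that swaps commute with the completion.
   Each pair is then sensitive with probability at least l ^ (- 2k), whereas the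
   sum of these probabilities, a total influence, is at most 4k as the degree is
   at most k.  Hence m <= 4k l ^ (2k), and f depends on the coordinates of a
   maximal matching of noninvariant pairs.

   Applied to a slice with many coordinates this shows that gamma is well
   defined.  Finally the grid over the coordinates on which f depends embeds in
   the slice without raising the degree, which improves the bound to gamma. *)

Require Import Defs.
From mathcomp Require Import boolp classical_sets reals.
From mathcomp Require Import all_boot all_order all_algebra all_fingroup.
From mathcomp Require Import ring lra zify.

Set Implicit Arguments.
Unset Strict Implicit.
Unset Printing Implicit Defensive.

Import Order.TTheory GRing.Theory Num.Theory.

Local Open Scope ring_scope.

(** Greedy extension, by induction on the room [K - size s] that is left. *)
Lemma exists_maximal_seq (T : finType) (P : pred (seq T)) (K : nat) :
  (forall s, P s -> (size s <= K)%N) -> P [::] ->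
  exists2 s, P s & forall x, ~~ P (x :: s).
Proof.
move=> leK; have: (K - size (@nil T) <= K)%N by rewrite leq_subr.
elim: {2}K [::] => [|d IHd] s leKs Ps.
- exists s => // x; apply/negP => /leK /=.
  by have := leK _ Ps; move: leKs; lia.
- have [/existsP[x Pxs]|/existsPn nP] := boolP [exists x, P (x :: s)].
  + by apply: (IHd (x :: s)) => //=; lia.
  + by exists s.
Qed.

Lemma tpermCA (I : finType) (a b c d : I) :
  a \notin [:: c; d] -> b \notin [:: c; d] ->
  forall j, tperm a b (tperm c d j) = tperm c d (tperm a b j).
Proof.
rewrite !inE !negb_or => /andP[ac ad] /andP[bc bd] j.
rewrite -!permM; congr (fun_of_perm _ j).
by rewrite conjgC tpermJ !tpermD // eq_sym.
Qed.

(** * Swaps of coordinates and iterated differences *)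

Section Words.
Variables (R : realFieldType) (I L : finType).
Local Notation word := {ffun I -> L}.
Implicit Types (u v : word) (e : I * I) (s : seq (I * I)) (f g : word -> R).
Implicit Types (T : {set I}).

Definition swap e u : word := [ffun j => u (tperm e.1 e.2 j)].
Definition swaps s u : word := foldr swap u s.
Definition diff e f : word -> R := fun u => f u - f (swap e u).
Definition diffs s f : word -> R := foldr diff f s.

Definition coords s : seq I := flatten [seq [:: e.1; e.2] | e <- s].

Lemma coords_cat s1 s2 : coords (s1 ++ s2) = coords s1 ++ coords s2.
Proof. by rewrite /coords map_cat flatten_cat. Qed.

Lemma size_coords s : size (coords s) = (2 * size s)%N.
Proof. by elim: s => //= e s IHs; rewrite IHs mulnS. Qed.

Lemma mem_coords s e : e \in s -> (e.1 \in coords s) && (e.2 \in coords s).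
Proof.
elim: s => //= e' s IHs; rewrite !inE => /orP[/eqP->|/IHs/andP[-> ->]].
  by rewrite !eqxx !orbT.
by rewrite !orbT.
Qed.

Lemma subseq_coords s1 s2 : subseq s1 s2 -> subseq (coords s1) (coords s2).
Proof.
elim: s2 s1 => [|e s2 IH] [|e1 s1]; rewrite ?sub0seq //.
rewrite [subseq (_ :: _) _]/=; case: eqP => [->|_] /IH sub.
  by rewrite /= !eqxx.
by apply: (subseq_trans sub); exact: (suffix_subseq [:: _; _]).
Qed.

Lemma swapK e : involutive (swap e).
Proof. by move=> u; apply/ffunP => j; rewrite !ffunE tpermK. Qed.

Lemma swap_out e u j : j != e.1 -> j != e.2 -> swap e u j = u j.
Proof. by move=> j1 j2; rewrite ffunE tpermD // eq_sym. Qed.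

Lemma swapC e1 e2 u :
  e1.1 \notin [:: e2.1; e2.2] -> e1.2 \notin [:: e2.1; e2.2] ->
  swap e1 (swap e2 u) = swap e2 (swap e1 u).
Proof. by move=> d1 d2; apply/ffunP => j; rewrite !ffunE -tpermCA. Qed.

Lemma diffs_rcons s e f : diffs (rcons s e) f = diffs s (diff e f).
Proof. by rewrite /diffs foldr_rcons. Qed.

Lemma diffC e1 e2 f :
  e1.1 \notin [:: e2.1; e2.2] -> e1.2 \notin [:: e2.1; e2.2] ->
  diff e1 (diff e2 f) = diff e2 (diff e1 f).
Proof.
by move=> d1 d2; apply/funext => u; rewrite /diff (swapC _ d1 d2); ring.
Qed.

Lemma diffs_diffC e s f : e.1 \notin coords s -> e.2 \notin coords s ->
  diffs s (diff e f) = diff e (diffs s f).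
Proof.
elim: s => //= e' s IHs; rewrite !inE !negb_or.
move=> /and3P[n11 n12 n1] /and3P[n21 n22 n2].
by rewrite IHs // diffC // !inE negb_or ![_ == e.1]eq_sym ![_ == e.2]eq_sym
  ?n11 ?n12 ?n21.
Qed.

(** An iterated difference is a signed sum of values of [f] at words obtained from [u] by swaps from
    [s]; if the sum is nonzero, so is some term. *)
Lemma diffs_ne0 s f u : diffs s f u != 0 ->
  exists2 s', {subset s' <= s} & f (swaps s' u) != 0.
Proof.
elim: s u => [|e s IHs] u /=; first by exists [::].
rewrite /diff => H.
have [/IHs[s' ss' fs']|H0] := boolP (diffs s f u != 0).
  by exists s' => // x /ss'; rewrite inE orbC => ->.
have: diffs s f (swap e u) != 0.
  apply: contra H => /eqP->; move: H0; rewrite negbK => /eqP->.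
  by rewrite subr0.
move=> /IHs[s' ss' fs']; exists (rcons s' e).
  by move=> x; rewrite mem_rcons !inE => /orP[->//|/ss'->]; rewrite orbT.
by rewrite /swaps foldr_rcons.
Qed.

Lemma swaps_out s T u : (forall e, e \in s -> (e.1 \in T) && (e.2 \in T)) ->
  {in ~: T, swaps s u =1 u}.
Proof.
move=> sT j; rewrite inE => jT; elim: s sT => //= e s IHs sT.
have /andP[e1 e2] := sT e (mem_head _ _).
rewrite swap_out ?IHs //; first by move=> e' e's; rewrite sT // inE e's orbT.
- by apply: contraNneq jT => ->.
- by apply: contraNneq jT => ->.
Qed.

(** * The energy inequality on the space of all words *)

Definition sqnorm f := \sum_u f u ^+ 2.
Definition energy e f := \sum_u diff e f u ^+ 2.

Lemma sum_swap e f : \sum_u f (swap e u) = \sum_u f u.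
Proof. by rewrite [RHS](reindex_inj (inv_inj (swapK e))). Qed.


Definition cosum e f : word -> R := fun u => f u + f (swap e u).

Lemma sqnorm_ge0 f : 0 <= sqnorm f.
Proof. by apply: sumr_ge0 => u _; exact: sqr_ge0. Qed.

Lemma diffs0 s f : f =1 (fun=> 0) -> diffs s f =1 (fun=> 0).
Proof. by move=> f0; elim: s => //= e s IHs u; rewrite /diff !IHs subrr. Qed.

Lemma diffs_cosum s e f u :
  diffs s (cosum e f) u = 2 * diffs s f u - diffs s (diff e f) u.
Proof.
elim: s u => [|e' s IHs] u /=; first by rewrite /cosum /diff; ring.
by rewrite /diff !IHs /diff; ring.
Qed.

Lemma sqnorm_parallelogram e f :
  sqnorm (diff e f) + sqnorm (cosum e f) = 4 * sqnorm f.
Proof.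
have -> : 4 * sqnorm f = 2 * sqnorm f + 2 * \sum_u f (swap e u) ^+ 2.
  by rewrite (sum_swap e (fun u => f u ^+ 2)) /sqnorm; ring.
rewrite /sqnorm !mulr_sumr -!big_split /=.
by apply: eq_bigr => u _; rewrite /diff /cosum; ring.
Qed.

Lemma diff_cosumC e1 e2 f :
  e1.1 \notin [:: e2.1; e2.2] -> e1.2 \notin [:: e2.1; e2.2] ->
  diff e1 (cosum e2 f) = cosum e2 (diff e1 f).
Proof.
by move=> d1 d2; apply/funext => u; rewrite /diff /cosum (swapC _ d1 d2); ring.
Qed.

(* The involutions [swap e] commute, so [f] splits into joint eigenfunctions,
   and the hypothesis says that only those with at most [k] eigenvalues [-1]
   occur.  The induction peels off one involution at a time. *)
Lemma sum_energy_le k s f : uniq (coords s) ->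
  (forall s', subseq s' s -> size s' = k.+1 -> diffs s' f =1 (fun=> 0)) ->
  \sum_(e <- s) energy e f <= 4 * k%:R * sqnorm f.
Proof.
elim: s k f => [|e s IHs] k f us f0.
  by rewrite big_nil !mulr_ge0 ?sqnorm_ge0.
case: k f0 => [|k] f0.
  rewrite mulr0 mul0r big_seq big1 // => e' e's.
  rewrite /energy big1 // => u _.
  have sub : subseq [:: e'] (e :: s) by rewrite sub1seq.
  by have /= -> := f0 _ sub erefl u; rewrite expr0n.
move: us; rewrite /= !inE negb_or => /and3P[/andP[n12 n1] n2 us].
have dj e' : e' \in s -> e'.1 \notin [:: e.1; e.2] /\ e'.2 \notin [:: e.1; e.2].
  move=> /mem_coords/andP[c1 c2]; rewrite !inE !negb_or.
  split; apply/andP; split.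
  - by apply: contraNneq n1 => <-.
  - by apply: contraNneq n2 => <-.
  - by apply: contraNneq n1 => <-.
  - by apply: contraNneq n2 => <-.
have dA s' : subseq s' s -> diffs s' (diff e f) = diffs (e :: s') f.
  move=> /subseq_coords/mem_subseq sub; rewrite diffs_diffC //.
  - by apply: contra n1 => /sub.
  - by apply: contra n2 => /sub.
(* [diff e f] is twice the part of [f] with eigenvalue -1 under [swap e]. One eigenvalue -1 is
   spent, so only [k] remain; the part [cosum e f] still allows [k.+1]. *)
have leA : \sum_(e' <- s) energy e' (diff e f) <= 4 * k%:R * sqnorm (diff e f).
  by apply: IHs => // s' ss' sz; rewrite dA //; apply: f0; rewrite /= ?eqxx ?sz.
have leB : \sum_(e' <- s) energy e' (cosum e f)
    <= 4 * k.+1%:R * sqnorm (cosum e f).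
  apply: IHs => // s' ss' sz u; rewrite diffs_cosum dA //= /diff.
  have f0' := f0 s' (subseq_trans ss' (subseq_cons _ _)) sz.
  by rewrite !f0'; ring.
(* The parallelogram identity for each [diff e' f]. In the final sum, the gap between [k] and [k.+1]
   in [leA] pays for the term [energy e f]. *)
have EA : 4 * \sum_(e' <- s) energy e' f = \sum_(e' <- s) energy e' (diff e f)
    + \sum_(e' <- s) energy e' (cosum e f).
  rewrite mulr_sumr -big_split /= big_seq [RHS]big_seq.
  apply: eq_bigr => e' e's.
  have [d1 d2] := dj _ e's.
  rewrite -[LHS](sqnorm_parallelogram e (diff e' f)) /energy.
  by rewrite -[sqnorm (cosum _ _)]/(\sum_u _) -diff_cosumC // -diffC.
have E := sqnorm_parallelogram e f.
have := congr1 ( *%R k%:R) E.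
rewrite big_cons -[energy e f]/(sqnorm (diff e f)) -(natr1 k).
move: leB; rewrite -(natr1 k) mulrDr; lra.
Qed.

(** * Functions on a slice *)

Variable kappa : L -> nat.

(** Arbitrary finite types of coordinates and letters are allowed, so that coordinates can be added
    to a grid as a disjoint sum. *)
Definition slice : {set word} :=
  [set u : word | [forall i, #|[set j | u j == i]| == kappa i]].
Local Notation X := slice.

Definition depends_on T f :=
  forall u v, u \in X -> v \in X -> {in T, u =1 v} -> f u = f v.

Definition invariant e f := [forall u in X, f (swap e u) == f u].

Definition vanishing k f := forall s, uniq (coords s) -> (k < size s)%N ->
  {in X, diffs s f =1 (fun=> 0)}.

Lemma sliceP u : reflect (forall i, #|[set j | u j == i]| = kappa i) (u \in X).
Proof. by rewrite inE; apply: (iffP forallP) => H i; apply/eqP. Qed.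

Lemma slice_comp (p : I -> I) u : injective p -> u \in X ->
  [ffun j => u (p j)] \in X.
Proof.
move=> p_inj /sliceP uX; apply/sliceP => i.
rewrite -uX -[RHS](card_preimset _ p_inj).
by apply: eq_card => j; rewrite !inE ffunE.
Qed.

Lemma slice_swap e u : u \in X -> swap e u \in X.
Proof. by move=> uX; apply: slice_comp uX; exact: perm_inj. Qed.

Lemma eq_in_diffs s f g : {in X, f =1 g} -> {in X, diffs s f =1 diffs s g}.
Proof.
by move=> fg; elim: s => //= e s IHs u uX; rewrite /diff !IHs ?slice_swap.
Qed.

Lemma diffs_sum s r (c : 'I_r -> R) (g : 'I_r -> word -> R) u :
  diffs s (fun u => \sum_(i < r) c i * g i u) u =
  \sum_(i < r) c i * diffs s (g i) u.
Proof.
elim: s u => //= e s IHs u; rewrite /diff !IHs -sumrB.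
by apply: eq_bigr => i _; rewrite mulrBr.
Qed.

(** By pigeonhole some pair of [s] misses [T]. Its difference kills [f], and it can be applied first
    because differences along disjoint pairs commute. *)
Lemma diffs_depends s T f : uniq (coords s) -> (#|T| < size s)%N ->
  depends_on T f -> {in X, diffs s f =1 (fun=> 0)}.
Proof.
move=> us Ts fT.
have [e es eT] : exists2 e, e \in s & (e.1 \notin T) && (e.2 \notin T).
  apply/hasP; apply: contraLR Ts; rewrite -all_predC => /allP sT.
  rewrite -leqNgt.
  (* If every pair met [T], choosing a point of [T] in each would inject [s] into [T], as the pairs
     are disjoint. *)
  pose h (e : I * I) := if e.1 \in T then e.1 else e.2.
  have hT e : e \in s -> h e \in T.
    by move=> /sT /=; rewrite negb_and !negbK /h; case: ifP.
  have hc e : h e = e.1 \/ h e = e.2 by rewrite /h; case: ifP; [left|right].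
  have uh : uniq (map h s).
    elim: s us {sT hT} => //= e s IHs.
    rewrite inE negb_or => /and3P[/andP[_ n1] n2 /IHs->]; rewrite andbT.
    apply/mapP => -[e' /mem_coords/andP[c1 c2] E].
    have he' : h e' \in coords s by case: (hc e') => ->.
    by case: (hc e) n1 n2 => <-; rewrite E he'.
  rewrite -(size_map h) -(card_uniqP uh); apply: subset_leq_card.
  by apply/subsetP => _ /mapP[e es ->]; exact: hT.
have [s1 [s2 E]] : exists s1 s2, s = s1 ++ e :: s2.
  by case/splitPr: es => s1 s2; exists s1, s2.
have f0 : {in X, diff e f =1 (fun=> 0)}.
  move=> u uX; rewrite /diff; apply/eqP; rewrite subr_eq0; apply/eqP.
  apply: fT; rewrite ?slice_swap // => j jT; case/andP: eT => e1 e2.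
  by rewrite swap_out //; [apply: contraNneq e1|apply: contraNneq e2] => <-.
move: us; rewrite {}E coords_cat cat_uniq => /and3P[_ _].
rewrite /= inE negb_or => /and3P[/andP[_ n1] n2 _].
rewrite /diffs foldr_cat /= -/(diffs s2 f) -diffs_diffC // -/(diffs s1 _).
have diffs_eq0 s' g : {in X, g =1 (fun=> 0)} -> {in X, diffs s' g =1 (fun=> 0)}.
  by move=> /eq_in_diffs g0 u uX; rewrite g0 // diffs0.
exact: (diffs_eq0 _ _ (diffs_eq0 _ _ f0)).
Qed.

Lemma vanishing_sum k f r (c : 'I_r -> R) (g : 'I_r -> word -> R) :
  (forall i, exists2 T : {set I}, (#|T| <= k)%N & depends_on T (g i)) ->
  {in X, f =1 fun u => \sum_(i < r) c i * g i u} -> vanishing k f.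
Proof.
move=> gk fE s us ks u uX.
rewrite (eq_in_diffs _ fE) // diffs_sum big1 // => i _.
have [T Tk gT] := gk i.
by rewrite (diffs_depends us _ gT) ?mulr0 // (leq_ltn_trans Tk).
Qed.

(** Induction on the number of disagreements between [u] and [v]: a swap outside [T] repairs one
    without creating another. *)
Lemma invariant_outside T f :
  (forall a b, a \notin T -> b \notin T -> a != b -> invariant (a, b) f) ->
  depends_on T f.
Proof.
move=> fT u v.
have [n] := ubnP #|[set j | u j != v j]|; elim: n u => // n IHn u.
rewrite ltnS => le_n uX vX uv.
have [D0|] := eqVneq [set j | u j != v j] set0.
  congr f; apply/ffunP => j; apply/eqP; rewrite -[_ == _]negbK.
  by apply/negP => jD; have := in_set0 j; rewrite -D0 inE jD.
case/set0Pn => j; rewrite inE => uvj.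
have notT i : u i != v i -> i \notin T by apply: contraNN => /uv->.
(* The letter [v j] occurs equally often in [u] and [v], and [j] is an occurrence in [v] but not in
   [u], so [u] has an occurrence that [v] lacks. *)
have [j' uj' vj'] : exists2 j', u j' = v j & v j' != v j.
  have [/existsP[j' /andP[/eqP]]|/existsPn nex] :=
    boolP [exists j', (u j' == v j) && (v j' != v j)]; first by exists j'.
  have sub : [set i | u i == v j] \subset [set i | v i == v j].
    apply/subsetP => i; rewrite !inE => ui.
    by have := nex i; rewrite ui negbK.
  have: [set i | u i == v j] = [set i | v i == v j].
    apply/eqP; rewrite eqEcard sub /=.
    by move/sliceP: uX => ->; move/sliceP: vX => ->.
  by move/setP/(_ j); rewrite !inE eqxx (negbTE uvj).
have jj' : j != j'.
  by apply: contraNneq uvj => jj'; rewrite jj' in uj' *; rewrite uj'.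
have j'T : j' \notin T by apply: notT; rewrite uj' eq_sym.
have jT := notT _ uvj.
have /forall_inP/(_ u uX)/eqP <- := fT _ _ jT j'T jj'.
apply: IHn => //; last 2 first.
- exact: slice_swap.
- move=> i iT; rewrite swap_out ?uv //=.
  + by apply: contraNneq jT => <-.
  + by apply: contraNneq j'T => <-.
apply: leq_trans le_n; apply: proper_card; apply/properP; split.
  apply/subsetP => i; rewrite !inE ffunE /=.
  by case: tpermP => [->|->|//]; rewrite uj' ?eqxx // [v j == _]eq_sym vj'.
exists j; first by rewrite inE.
by rewrite !inE ffunE /= tpermL uj' eqxx.
Qed.

(** * Local sensitivity to a noninvariant pair *)

(** A maximal chain of disjoint pairs with nonzero difference has length at most [k]. By maximality
    its difference is invariant outside the coordinates [T] of the chain, so it is nonzero wherever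
    the word agrees on [T] with a point [a] of nonvanishing. The pair [e] is differenced first, so
    [diffs_ne0] on the others leaves [diff e f] nonzero. *)
Lemma robustly_sensitive k f e : vanishing k f -> ~~ invariant e f ->
  exists (T : {set I}) (a : word),
    [/\ (#|T| <= 2 * k)%N, e.1 \in T, e.2 \in T
      & forall v, v \in X -> {in T, v =1 a} ->
        exists2 s, forall e', e' \in s -> (e'.1 \in T) && (e'.2 \in T)
                 & f (swap e (swaps s v)) != f (swaps s v)].
Proof.
move=> fk ninv.
have e12 : e.1 != e.2.
  apply: contra ninv => /eqP e12; apply/forall_inP => u _.
  by apply/eqP; congr f; apply/ffunP => j; rewrite ffunE e12 tperm1 perm1.
pose P s := uniq (coords (rcons s e)) &&
  [exists u in X, diffs (rcons s e) f u != 0].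
have Psize s : P s -> (size s <= k)%N.
  move=> /andP[us /exists_inP[u uX]]; apply: contraNT; rewrite -ltnNge => ks.
  by apply/eqP; apply: fk => //; rewrite size_rcons ltnS ltnW.
have P0 : P [::].
  rewrite /P /= !inE e12 /=; move: ninv; rewrite negb_forall_in.
  move=> /exists_inP[u uX fu]; apply/exists_inP; exists u => //.
  by rewrite /diff subr_eq0 eq_sym.
have [s /andP[us /exists_inP[a aX fa]] maxs] := exists_maximal_seq Psize P0.
exists [set j in coords (rcons s e)], a.
have sk : (size (rcons s e) <= k)%N.
  by rewrite leqNgt; apply: contra fa => ks; apply/eqP; apply: fk.
have cin e' : e' \in rcons s e ->
    (e'.1 \in [set j in coords (rcons s e)]) &&
    (e'.2 \in [set j in coords (rcons s e)]).
  by rewrite !inE; exact: mem_coords.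
have /andP[e1T e2T] : (e.1 \in [set j in coords (rcons s e)]) &&
    (e.2 \in [set j in coords (rcons s e)]).
  by rewrite cin // mem_rcons mem_head.
split=> //.
  by rewrite cardsE (leq_trans (card_size _)) // size_coords leq_mul2l sk.
move=> v vX va.
have: diffs (rcons s e) f v != 0.
  rewrite (_ : diffs _ f v = diffs (rcons s e) f a) //.
  apply: (invariant_outside (T := [set j in coords (rcons s e)])) => // x y.
  rewrite !inE => xT yT xy; apply/forall_inP => u uX.
  have := maxs (x, y); rewrite /P [coords _]/= /= !inE negb_or xy xT yT us /=.
  rewrite negb_exists_in => /forall_inP/(_ u uX).
  by rewrite negbK /diff subr_eq0 eq_sym.
rewrite diffs_rcons => /diffs_ne0[s' ss' fs'].
exists s'.
  by move=> e' /ss' e's; apply: cin; rewrite mem_rcons inE e's orbT.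
by move: fs'; rewrite /diff subr_eq0 eq_sym.
Qed.

(** * Completing partial words to words of the slice *)

Lemma complete (s : seq I) (u0 y : word) : u0 \in X ->
  (forall i, size s <= kappa i)%N -> exists2 u, u \in X & {in s, u =1 y}.
Proof.
move=> u0X; elim: s => [|z s IHs] les; first by exists u0.
have [|u uX uy] := IHs; first by move=> i; exact: ltnW (les i).
have [uz|uz] := eqVneq (u z) (y z).
  by exists u => // j; rewrite inE => /predU1P[->|/uy].
have [zs|zs] := boolP (z \in s); first by rewrite uy ?eqxx in uz.
(* The letter [y z] occurs more than [size s] times in [u], hence also outside [s]; bringing it to
   [z] leaves the positions of [s] untouched. *)
have [j uj js] : exists2 j, u j = y z & j \notin s.
  have /subsetPn[j] : ~~ ([set j | u j == y z] \subset s).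
    apply: contraL (les (y z)) => /subset_leq_card; move/sliceP: uX => ->.
    by rewrite -ltnNge => /leq_ltn_trans; apply; rewrite ltnS card_size.
  by rewrite inE => /eqP uj js; exists j.
exists (swap (z, j) u); first exact: slice_swap.
move=> i; rewrite inE => /predU1P[->|ins]; first by rewrite ffunE tpermL.
rewrite swap_out ?uy //=.
  by apply: contraNneq zs => <-.
by apply: contraNneq js => <-.
Qed.

(* The letters outside [V] are a function of the letter counts of [y] in [V]
   only, hence commutation with the swaps inside [V]. *)
Lemma equivariant_completion (V : {set I}) (u0 : word) : u0 \in X ->
  (forall i, #|V| <= kappa i)%N ->
  exists c : word -> word,
    [/\ forall y, c y \in X, forall y, {in V, c y =1 y}
      & forall e y, e.1 \in V -> e.2 \in V -> c (swap e y) = swap e (c y)].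
Proof.
move=> u0X leV.
pose cnt (y : word) : {ffun L -> nat} :=
  [ffun i => #|[set j | y j == i] :&: V|].
pose fits (t : {ffun L -> nat}) (w : word) :=
  [forall i, t i + #|[set j | w j == i] :\: V| == kappa i]%N.
pose fill t := odflt u0 [pick w | fits t w].
pose c (y : word) : word := [ffun j => if j \in V then y j else fill (cnt y) j].
have cV y : {in V, c y =1 y} by move=> j jV; rewrite ffunE jV.
exists c; split=> //.
  (* The word given by [complete] fits, so [pick] succeeds and the default [u0] is not reached. *)
  move=> y; have fity : fits (cnt y) (fill (cnt y)).
    rewrite /fill; case: pickP => //= nofit.
    have [|u uX uy] := complete (s := enum V) y u0X.
      by move=> i; rewrite -cardE.
    have := nofit u; rewrite /fits => /negP[]; apply/forallP => i.
    rewrite ffunE; move/sliceP: uX => /(_ i) <-.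
    rewrite -[X in _ == X](cardsID V) eqn_add2r; apply/eqP/eq_card => j.
    rewrite !inE; case jV: (j \in V); rewrite ?andbF // !andbT uy //.
    by rewrite mem_enum.
  apply/sliceP => i; move/forallP: fity => /(_ i)/eqP <-.
  rewrite -(cardsID V) ffunE; congr (_ + _)%N; apply: eq_card => j.
    by rewrite !inE ffunE; case: (j \in V); rewrite ?andbF.
  by rewrite !inE ffunE; case: (j \in V).
move=> e y e1 e2.
have VE j : (tperm e.1 e.2 j \in V) = (j \in V).
  by case: tpermP => [->|->|//]; rewrite e1 e2.
have cntE : cnt (swap e y) = cnt y.
  apply/ffunP => i; rewrite !ffunE.
  rewrite -[RHS](card_preimset _ (@perm_inj _ (tperm e.1 e.2))).
  by apply: eq_card => j; rewrite !inE ffunE VE.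
apply/ffunP => j; rewrite !ffunE cntE VE; case: ifP => // jV.
by rewrite tpermD //; apply: contraFneq jV => <-.
Qed.

(** * Counting sensitive words and bounding matchings *)

Lemma card_agree (T : {set I}) (a : word) :
  (#|[set y : word | [forall j in T, y j == a j]]| * #|L| ^ #|T|)%N
    = (#|L| ^ #|I|)%N.
Proof.
pose F j : pred L := if j \in T then pred1 (a j) else predT.
have -> : #|[set y : word | [forall j in T, y j == a j]]| = #|family F|.
  apply: eq_card => y; rewrite inE.
  apply/forall_inP/familyP => [H j|H j jT]; have := H j; rewrite /F.
    by case: ifP => // jT /(_ isT).
  by rewrite jT.
rewrite card_family foldrE big_image /= (bigID (mem T)) /= big1 => [|j jT].
  rewrite mul1n (eq_bigr (fun=> #|L|)) => [|j /negbTE jT]; last first.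
    by rewrite /F jT; apply: eq_card.
  rewrite prod_nat_const -expnD -(cardsC T) addnC; congr (_ ^ (_ + _))%N.
  by apply: eq_card => j; rewrite !inE.
by rewrite /F jT card1.
Qed.

(** Words with the pattern [a] on [T] inject into the sensitive words: apply to each the swaps that
    [robust] provides for its completion. These swaps move only coordinates in [T], where the
    original word is known to be [a], so it can be recovered. *)
Lemma card_sensitive k f e (V : {set I}) (c : word -> word) (T : {set I})
    (a : word) :
  (0 < #|L|)%N -> T \subset V -> (#|T| <= k)%N -> e.1 \in T -> e.2 \in T ->
  (forall y, c y \in X) -> (forall y, {in V, c y =1 y}) ->
  (forall e' y, e'.1 \in V -> e'.2 \in V -> c (swap e' y) = swap e' (c y)) ->
  (forall v, v \in X -> {in T, v =1 a} ->
     exists2 s, forall e', e' \in s -> (e'.1 \in T) && (e'.2 \in T)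
              & f (swap e (swaps s v)) != f (swaps s v)) ->
  (#|L| ^ #|I| <= #|[set y | f (c (swap e y)) != f (c y)]| * #|L| ^ k)%N.
Proof.
move=> L0 TV Tk e1 e2 cX cV cswap robust.
rewrite -(card_agree T a) leq_mul ?leq_pexp2l //.
have cswaps s y : (forall e', e' \in s -> (e'.1 \in T) && (e'.2 \in T)) ->
    c (swaps s y) = swaps s (c y).
  elim: s => //= e' s IHs sT.
  have /andP[e1' e2'] := sT e' (mem_head _ _).
  rewrite cswap ?(subsetP TV) // IHs // => e'' e''s.
  by rewrite sT // inE e''s orbT.
have /fin_all_exists[sel selP] : forall y : word, exists s : seq (I * I),
    [forall j in T, y j == a j] ->
    (forall e', e' \in s -> (e'.1 \in T) && (e'.2 \in T)) /\
    f (swap e (swaps s (c y))) != f (swaps s (c y)).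
  move=> y.
  have [/forall_inP ya|_] := boolP [forall j in T, y j == a j]; last first.
    by exists [::].
  have [|s sT fs] := robust (c y) (cX y); last by exists s.
  by move=> j jT; rewrite cV ?(subsetP TV) //; apply/eqP/ya.
rewrite -(card_in_imset (f := fun y => swaps (sel y) y)); last first.
  move=> y y'; rewrite !inE => ya y'a E; apply/ffunP => j.
  have [jT|jT] := boolP (j \in T).
    by rewrite (eqP (forall_inP ya _ jT)) (eqP (forall_inP y'a _ jT)).
  have := congr1 (fun w : word => w j) E.
  have [[sT _] [s'T _]] := (selP _ ya, selP _ y'a).
  by rewrite /= !(swaps_out (T := T)) ?inE.
apply/subset_leq_card/subsetP => _ /imsetP[y + ->].
rewrite !inE => /selP[sT fs].
by rewrite cswap ?(subsetP TV) // cswaps.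
Qed.

(** Double counting of the sensitive words over the pairs of [s]: [card_sensitive] bounds from
    below, [sum_energy_le] from above. The bound on [kappa] leaves room to complete words prescribed
    on the union of the sets [T e]. *)
Lemma size_noninvariant_matching k f u0 s : (0 < #|L|)%N -> u0 \in X ->
  (forall u, u \in X -> f u = 0 \/ f u = 1) -> vanishing k f ->
  uniq (coords s) -> (forall e, e \in s -> ~~ invariant e f) ->
  (forall i, 2 * k * size s <= kappa i)%N ->
  (size s <= 4 * k * #|L| ^ (2 * k))%N.
Proof.
move=> L0 u0X f01 fk us ninv lek.
have /fin_all_exists[Ta TaP] : forall e, exists Ta : {set I} * word, e \in s ->
    [/\ (#|Ta.1| <= 2 * k)%N, e.1 \in Ta.1, e.2 \in Ta.1
      & forall v, v \in X -> {in Ta.1, v =1 Ta.2} ->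
        exists2 s, forall e', e' \in s -> (e'.1 \in Ta.1) && (e'.2 \in Ta.1)
                 & f (swap e (swaps s v)) != f (swaps s v)].
  move=> e; have [/ninv/(robustly_sensitive fk)[T [a Ta]]|_] := boolP (e \in s).
    by exists (T, a).
  by exists (set0, u0).
pose T e := (Ta e).1.
pose V := \bigcup_(e <- s) T e.
have TV e : e \in s -> T e \subset V.
  by move=> es; rewrite /V (big_rem e) //= subsetUl.
have leV i : (#|V| <= kappa i)%N.
  apply: leq_trans (lek i); rewrite /V.
  have: forall e, e \in s -> (#|T e| <= 2 * k)%N by move=> e /TaP[].
  elim: (s) => [|e s' IHs] leT; first by rewrite big_nil cards0.
  rewrite big_cons (leq_trans (leq_card_setU _ _)) //= mulnS leq_add //.
    by rewrite leT ?mem_head.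
  by apply: IHs => e' e's; rewrite leT // inE e's orbT.
have [c [cX cV cswap]] := equivariant_completion u0X leV.
pose G := f \o c.
(* Equivariance of [c] transfers vanishing from [f] on the slice to [G] on all words. *)
have diffsG s' y : {subset s' <= s} -> diffs s' G y = diffs s' f (c y).
  elim: s' y => //= e s' IHs y sub.
  have /TaP[_ e1 e2 _] := sub e (mem_head _ _).
  have eV := subsetP (TV e (sub e (mem_head _ _))).
  rewrite /diff !IHs; last 2 first.
  - by move=> e' e's; rewrite sub // inE e's orbT.
  - by move=> e' e's; rewrite sub // inE e's orbT.
  by rewrite cswap ?eV.
pose S e := [set y | f (c (swap e y)) != f (c y)].
have leS e : e \in s -> (#|L| ^ #|I| <= #|S e| * #|L| ^ (2 * k))%N.
  move=> es; have [Tk e1 e2 rob] := TaP e es.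
  exact: (card_sensitive L0 (TV e es) Tk e1 e2 cX cV cswap rob).
have ES e : energy e G = #|S e|%:R.
  rewrite -sum1_card natr_sum big_mkcond /=; apply: eq_bigr => y _.
  rewrite inE /diff /G /=; have := (f01 _ (cX y), f01 _ (cX (swap e y))).
  case=> -[->|->] [->|->];
    by rewrite ?eqxx ?oner_eq0 1?eq_sym ?oner_eq0 /=; ring.
have leG : sqnorm G <= (#|L| ^ #|I|)%N%:R.
  rewrite -card_ffun -sum1_card natr_sum; apply: ler_sum => y _.
  by rewrite /G /=; case: (f01 _ (cX y)) => ->; rewrite ?expr0n ?expr1n ?ler01.
have leE : (\sum_(e <- s) #|S e| <= 4 * k * #|L| ^ #|I|)%N.
  rewrite -(ler_nat R) natr_sum -(eq_bigr _ (fun e _ => ES e)).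
  apply: le_trans (sum_energy_le (k := k) us _) _.
    move=> s' ss' sz y; rewrite diffsG; last exact: mem_subseq.
    by apply: fk; rewrite ?sz // (subseq_uniq (subseq_coords ss')).
  by rewrite !natrM ler_wpM2l // mulr_ge0.
have LI0 : (0 < #|L| ^ #|I|)%N by rewrite expn_gt0 L0.
rewrite -(leq_pmul2r LI0).
apply: (@leq_trans (\sum_(e <- s) #|S e| * #|L| ^ (2 * k))).
  rewrite -sum1_size big_distrl /= big_seq [leqRHS]big_seq.
  by apply: leq_sum => e es; rewrite mul1n leS.
rewrite -big_distrl /= -mulnA [(_ ^ (2 * k) * _)%N]mulnC mulnA.
by rewrite leq_mul2r leE orbT.
Qed.

(* The coordinates of a maximal matching of noninvariant transpositions. *)
Lemma slice_junta k f u0 (m := (4 * k * #|L| ^ (2 * k))%N) :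
  (0 < #|L|)%N -> u0 \in X ->
  (forall u, u \in X -> f u = 0 \/ f u = 1) -> vanishing k f ->
  (forall i, 2 * k * m.+1 <= kappa i)%N ->
  exists2 J : {set I}, (#|J| <= 2 * m)%N & depends_on J f.
Proof.
move=> L0 u0X f01 fk lek.
pose P s := uniq (coords s) && all (fun e => ~~ invariant e f) s.
have Psize s : P s -> (size s <= m)%N.
  (* A longer matching is truncated to [m.+1] pairs, the most for which [kappa] is assumed large
     enough. *)
  move=> /andP[us /allP ninv]; rewrite leqNgt; apply/negP => ms.
  have sz : size (take m.+1 s) = m.+1 by rewrite size_takel.
  suff: (m.+1 <= m)%N by rewrite ltnn.
  rewrite -{1}sz; apply: (size_noninvariant_matching L0 u0X f01 fk).
  - move: us; rewrite -{1}(cat_take_drop m.+1 s) coords_cat cat_uniq.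
    by case/andP.
  - by move=> e /mem_take/ninv.
  - by rewrite sz.
have [s /andP[us ninv] maxs] := exists_maximal_seq Psize isT.
exists [set j in coords s].
  rewrite cardsE (leq_trans (card_size _)) // size_coords leq_mul2l.
  by rewrite Psize //; apply/andP.
apply: invariant_outside => x y; rewrite !inE => xs ys xy.
have := maxs (x, y).
by rewrite /P [coords _]/= /= !inE negb_or xy xs ys us ninv /= andbT negbK.
Qed.

End Words.

Arguments slice {I L} kappa.

(** * Existence of the junta bound [gamma] *)

(* A function of degree at most [k] on the grid is a function of degree at most
   [k] on a slice with many more coordinates, all of whose letters are frequent. *)
Lemma bounds_juntas_exp (R : realType) (l k : nat) : (0 < l)%N ->
  bounds_juntas R l k (2 * (4 * k * l ^ (2 * k))).
Proof.
move=> l0 n f f01 [r [c [g [gk fE]]]]; set m := (4 * k * _)%N.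
(* [N] extra copies of each letter: [n + 2 * m] to prescribe the grid coordinates and [J] in [lift],
   and [2 * k * m.+1] to apply [slice_junta]. *)
pose N := (n + 2 * m + 2 * k * m.+1)%N.
pose I : finType := ('I_n + 'I_N * 'I_l)%type.
pose ext (x : grid n l) : {ffun I -> 'I_l} :=
  [ffun z => match z with inl j => x j | inr p => p.2 end].
pose res (w : {ffun I -> 'I_l}) : grid n l := [ffun j => w (inl j)].
pose i0 := Ordinal l0.
pose u0 := ext [ffun=> i0].
pose kappa i := #|[set z | u0 z == i]|.
have u0X : u0 \in slice kappa by apply/sliceP.
have leN i : (N <= kappa i)%N.
  rewrite -[N in (N <= _)%N]card_ord -cardsT.
  rewrite -(card_imset (f := fun b => inr (b, i) : I)); last by move=> b b' [].
  by apply/subset_leq_card/subsetP => _ /imsetP[b _ ->]; rewrite inE ffunE.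
have f'v : vanishing kappa k (f \o res).
  apply: (vanishing_sum (c := c) (g := fun i => g i \o res)) => [i|u _].
    have [T [Tk gT]] := gk i; exists [set inl j | j in T].
      exact: leq_trans (leq_imset_card _ _) Tk.
    move=> u v _ _ uv; apply: gT; rewrite ?inE // => j jT; rewrite !ffunE.
    by apply: uv; apply: imset_f.
  by rewrite /= fE ?inE.
have [|||J Jm fJ] := slice_junta (f := f \o res) _ u0X _ f'v.
- by rewrite card_ord.
- by move=> u _; apply: f01; rewrite inE.
- by move=> i; apply: leq_trans (leN i); rewrite card_ord leq_addl.
rewrite card_ord -/m in Jm.
exists [set j | inl j \in J]; split.
  apply: leq_trans Jm.
  rewrite -(card_imset (f := inl : _ -> I)); last by move=> ? ? [].
  by apply/subset_leq_card/subsetP => _ /imsetP[j + ->]; rewrite inE.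
(* Grid words that agree on the grid part of [J] have lifts that agree on all of [J], since [ext]
   fixes the added letters. *)
have lift (x : grid n l) :
    exists2 u, u \in slice kappa & res u = x /\ {in J, u =1 ext x}.
  pose s := [seq inl j : I | j <- enum 'I_n] ++ enum J.
  have [|u uX uE] := complete (s := s) (ext x) u0X.
    move=> i; apply: leq_trans (leN i); rewrite size_cat size_map size_enum_ord.
    by rewrite -cardE /N -addnA leq_add2l (leq_trans Jm) // leq_addr.
  exists u => //; split; last first.
    by move=> z zJ; rewrite uE // mem_cat mem_enum zJ orbT.
  apply/ffunP => j; rewrite !ffunE uE ?ffunE //.
  by rewrite mem_cat map_f // mem_enum.
move=> x y _ _ xy.
have [u uX [ux uJ]] := lift x; have [v vX [vy vJ]] := lift y.
rewrite -ux -vy; apply: fJ => // z zJ; rewrite uJ // vJ // !ffunE.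
by case: z zJ => // j jJ; apply: xy; rewrite inE.
Qed.

Lemma gammaP (R : realType) (l k : nat) : (0 < l)%N ->
  bounds_juntas R l k (gamma R l k).
Proof.
move=> l0.
have ex : exists m, `[< bounds_juntas R l k m >].
  exists (2 * (4 * k * l ^ (2 * k)))%N.
  by apply/asboolP; exact: bounds_juntas_exp.
have exmin : exists m, bounds_juntas R l k m /\
    forall m', bounds_juntas R l k m' -> (m <= m')%N.
  case: (ex_minnP ex) => m /asboolP bm minm; exists m; split=> // m' bm'.
  by apply: minm; apply/asboolP.
by have [] := xgetPex 0%N exmin.
Qed.

(** * From a junta on the slice to a [gamma]-junta *)

(* The grid over [J] embeds in the slice: fix a word [u] equal to [i0] on [J] and
   disjoint blocks [psi (j, _)] of [l] coordinates carrying each letter once,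
   with [psi (j, i0)] the [j]-th coordinate of [J]; the letter [x j] is written
   there by exchanging it with [i0] within the block. *)
Lemma slice_junta_grid (R : realType) (n l k m : nat) (kappa : 'I_l -> nat)
    (f : grid n l -> R) (J : {set 'I_n}) :
  (0 < l)%N -> (forall i, #|J| <= kappa i)%N -> depends_on kappa J f ->
  zero_one_valued (slice kappa) f -> degree_le (slice kappa) k f ->
  bounds_juntas R l k m -> is_junta (slice kappa) m f.
Proof.
move=> l0 leJ fJ f01 [r [c [g [gk fE]]]] bm.
have [X0|[u0 u0X]] := set_0Vmem (slice kappa : {set grid n l}).
  by exists set0; rewrite cards0; split=> // u v; rewrite X0 in_set0.
pose i0 := Ordinal l0.
have [|u uX uJ] := complete (s := enum J) [ffun=> i0] u0X.
  by move=> i; rewrite -cardE.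
(* For a letter other than [i0], block [j] takes its [j]-th occurrence in [u]; every letter has at
   least [#|J|] occurrences, so [nth] stays in range. *)
pose psi (q : 'I_#|J| * 'I_l) := if q.2 == i0 then enum_val q.1
  else nth (enum_val q.1) (enum [set i | u i == q.2]) q.1.
have lt_size (j : 'I_#|J|) a : (j < size (enum [set i | u i == a]))%N.
  by rewrite -cardE; move/sliceP: uX => ->; exact: leq_trans (leJ a).
have u_psi q : u (psi q) = q.2.
  rewrite /psi; case: eqP => [->|_].
    by rewrite uJ ?ffunE // mem_enum enum_valP.
  have := mem_nth (enum_val q.1) (lt_size q.1 q.2).
  by rewrite mem_enum inE => /eqP.
have psi_inj : injective psi.
  move=> [j a] [j' a'] E.
  have Ea : a = a' by have := congr1 u E; rewrite !u_psi.
  move: E; rewrite -{}Ea /psi /=; case: eqP => _.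
    by move=> /enum_val_inj ->.
  rewrite (set_nth_default (enum_val j')) // => /eqP.
  by rewrite nth_uniq ?enum_uniq // => /eqP/val_inj->.
pose shift (x : grid #|J| l) i := if [pick q | psi q == i] is Some q
  then psi (q.1, tperm i0 (x q.1) q.2) else i.
have shift_psi x q : shift x (psi q) = psi (q.1, tperm i0 (x q.1) q.2).
  rewrite /shift; case: pickP => [q' /eqP/psi_inj-> //|/(_ q)].
  by rewrite eqxx.
have shift_inj x : injective (shift x).
  apply: inv_inj => i.
  case: (pickP (fun q => psi q == i)) => [q /eqP <-|noq].
    by rewrite !shift_psi /= tpermK; case: q.
  have E : shift x i = i by rewrite /shift; case: pickP => // q; rewrite noq.
  by rewrite !E.
pose phi x : grid n l := [ffun i => u (shift x i)].
have phiX x : phi x \in slice kappa by exact: slice_comp.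
have phiJ x j : phi x (enum_val j) = x j.
  have -> : enum_val j = psi (j, i0) by rewrite /psi eqxx.
  by rewrite ffunE shift_psi u_psi /= tpermL.
have [||J2 [J2m FJ2]] := bm _ (f \o phi).
- by move=> x _; exact: f01.
- exists r, c, (fun i => g i \o phi); split=> [i|x _]; last by rewrite /= fE.
  have [T [Tk gT]] := gk i.
  (* The letter [x j] affects only block [j]. The blocks are disjoint, so at most [#|T|] of them
     meet [T]. *)
  exists [set j | [exists a, psi (j, a) \in T]]; split.
    apply: leq_trans Tk; apply: (@leq_trans #|psi @^-1: T|).
      apply: leq_trans (leq_imset_card fst _).
      apply/subset_leq_card/subsetP => j; rewrite inE => /existsP[a ja].
      by apply/imsetP; exists (j, a); rewrite ?inE.
    rewrite -(card_imset _ psi_inj).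
    by apply/subset_leq_card/subsetP => _ /imsetP[q + ->]; rewrite inE.
  move=> x y _ _ xy; apply: gT => // z zT; rewrite !ffunE /shift.
  case: pickP => // q /eqP qz; rewrite xy // inE.
  by apply/existsP; exists q.2; rewrite -surjective_pairing qz.
exists [set enum_val j | j in J2]; split.
  exact: leq_trans (leq_imset_card _ _) J2m.
move=> v w vX wX vw.
have restrict z : z \in slice kappa -> f z = f (phi [ffun j => z (enum_val j)]).
  move=> zX; apply: fJ => // i iJ.
  by rewrite -(enum_rankK_in iJ iJ) phiJ ffunE.
rewrite (restrict _ vX) (restrict _ wX); apply: FJ2; rewrite ?inE // => j jJ2.
by rewrite !ffunE vw // imset_f.
Qed.

Theorem theorem4p29 :
  exists C : nat,
    forall (R : realType) (l k : nat) (kappa : 'I_l -> nat)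
           (f : {ffun 'I_(\sum_(i < l) kappa i)%N -> 'I_l} -> R),
      (2 <= l)%N -> (0 < k)%N ->
      (forall i : 'I_l, (0 < kappa i)%N) ->
      (forall i : 'I_l, (l ^ (C * k) <= kappa i)%N) ->
      zero_one_valued (multislice kappa) f ->
      degree_le (multislice kappa) k f ->
      is_junta (multislice kappa) (gamma R l k) f.
Proof.
(* With [B = l ^ (2 * k)], the requirements on [kappa] are at least [2 * k * (4 * k * B + 1)] and at
   least [8 * k * B]. From [k * k <= B] and [16 <= B * B], both are at most
   [16 * B ^ 2 <= B ^ 4 = l ^ (8 * k)]. *)
exists 8%N => R l k kappa f l2 k0 _ lek f01 fk.
have l0 : (0 < l)%N := ltnW l2.
have [X0|[u0 u0X]] := set_0Vmem (multislice kappa).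
  by exists set0; rewrite cards0; split=> // u v; rewrite X0 in_set0.
(* [multislice] is convertible to [slice] over ordinals. *)
change (is_junta (slice kappa) (gamma R l k) f).
have fv : vanishing kappa k f.
  have [r [c [g [gk fE]]]] := fk; apply: (vanishing_sum _ fE) => i.
  by have [T [Tk gT]] := gk i; exists T.
have kl : (k <= l ^ k)%N by rewrite ltnW // ltn_expl.
have l16 : (16 <= l ^ (4 * k))%N.
  apply: (@leq_trans (l ^ 4)); first by rewrite -[16%N]/(2 ^ 4)%N leq_exp2r.
  by rewrite leq_pexp2l // leq_pmulr.
pose B := (l ^ (2 * k))%N.
have E4 : (l ^ (4 * k) = B * B)%N by rewrite -expnD -mulnDl.
have E8 : (l ^ (8 * k) = (B * B) * (B * B))%N by rewrite -E4 -expnD -mulnDl.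
have kB : (k * k <= B)%N by rewrite /B mul2n -addnn expnD leq_mul.
have kkB : (k * k * B <= B * B)%N by rewrite leq_mul2r kB orbT.
have kkk : (k <= k * k)%N by rewrite leq_pmulr.
have kBB : (k * B <= k * k * B)%N by rewrite leq_mul2r kkk orbT.
have BBB : (B <= B * B)%N by rewrite leq_pmulr // expn_gt0 l0.
have l8 : (16 * (B * B) <= l ^ (8 * k))%N by rewrite E8 leq_mul2r -E4 l16 orbT.
have [||J Jm fJ] := slice_junta (f := f) _ u0X f01 fv.
- by rewrite card_ord.
- move=> i; apply: leq_trans (leq_trans l8 (lek i)); rewrite card_ord -/B.
  have -> : (2 * k * (4 * k * B).+1 = 8 * (k * k * B) + 2 * k)%N by ring.
  lia.
apply: (slice_junta_grid l0 _ fJ f01 fk (@gammaP R l k l0)) => i.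
apply: leq_trans Jm (leq_trans _ (leq_trans l8 (lek i))); rewrite card_ord -/B.
have -> : (2 * (4 * k * B) = 8 * (k * B))%N by ring.
lia.
Qed.
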